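(* Let $k,r,n$ be integers with $\lfloor k/2\rfloor+1\le r<k\le n$, let $\mathcal{H}=\{K_r,P_k\}$, and write $n=p(k-1)+q$ with integers $p\ge 0$ and $0\le q\le k-2$. If $k\ge 3$ is odd, then $$\mathrm{ex}(n,\mathcal{H})=p\,\mathrm{ex}(k-1,K_r)+\mathrm{ex}(q,K_r).$$ If $k\ge 4$ is even, then $$\mathrm{ex}(n,\mathcal{H})=\max\left\{p\,\mathrm{ex}(k-1,K_r)+\mathrm{ex}(q,K_r),\ \binom{\lfloor k/2\rfloor-1}{2}+(\lfloor k/2\rfloor-1)(n-\lfloor k/2\rfloor+1)\right\}.$$
   Context: Graphs are finite and simple. $P_k$ is the path with $k$ vertices. A graph is $\mathcal{H}$-free if it contains no member of $\mathcal{H}$ as a (not necessarily induced) subgraph; $\mathrm{ex}(n,\mathcal{H})$ is the maximum number of edges in an $n$-vertex $\mathcal{H}$-free graph, and $\mathrm{ex}(n,H)$ means $\mathrm{ex}(n,\{H\})$, with $\mathrm{ex}(0,K_r)=0$. *)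

(* Defs.v *)
From HB Require Import structures.
From mathcomp Require Import all_boot.

Set Implicit Arguments.
Unset Strict Implicit.
Unset Printing Implicit Defensive.

(* A simple graph on V is given by its edge set, a set of 2-element subsets. *)
Record sgraph (V : finType) := SGraph {
  edges : {set {set V}};
  edges_card2 : [forall e in edges, #|e| == 2]
}.
HB.instance Definition _ (V : finType) := [isSub for @edges V].
HB.instance Definition _ (V : finType) := [Finite of sgraph V by <:].

(* Not necessarily induced: edges go to edges, non-edges are unconstrained. *)
Definition has_subgraph (U V : finType) (H : sgraph U) (G : sgraph V) : bool :=
  [exists f : {ffun U -> V},
     injectiveb f && [forall e in edges H, f @: e \in edges G]].

(* Bundled with its vertex type, so that one family can mix vertex sets. *)
Record fin_graph := FinGraph { vertices : finType; graph_of : sgraph vertices }.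

Definition is_free (Hs : seq fin_graph) (V : finType) (G : sgraph V) : bool :=
  ~~ has (fun H => has_subgraph (graph_of H) G) Hs.

(* The maximum over no graphs is 0; every family whose members all have an
   edge leaves at least the edgeless graph. *)
Definition ex_family (n : nat) (Hs : seq fin_graph) : nat :=
  \max_(G : sgraph 'I_n | is_free Hs G) #|edges G|.

Lemma complete_subproof (r : nat) :
  [forall e in [set e : {set 'I_r} | #|e| == 2], #|e| == 2].
Proof. by apply/forall_inP => e; rewrite inE. Qed.

Definition complete (r : nat) : sgraph 'I_r :=
  @SGraph 'I_r [set e : {set 'I_r} | #|e| == 2] (complete_subproof r).

Lemma path_graph_subproof (k : nat) :
  [forall e in [set [set u.1; u.2] | u : 'I_k * 'I_k & u.2 == u.1.+1 :> nat],
     #|e| == 2].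
Proof.
apply/forall_inP => e /imsetP[[x y]]; rewrite inE /= => /eqP xy ->.
rewrite cards2; suff -> : x != y by [].
by rewrite -val_eqE /= xy neq_ltn ltnSn.
Qed.

(* k is the number of vertices, not of edges. *)
Definition path_graph (k : nat) : sgraph 'I_k :=
  @SGraph 'I_k
    [set [set u.1; u.2] | u : 'I_k * 'I_k & u.2 == u.1.+1 :> nat]
    (path_graph_subproof k).

Definition ex_single (n : nat) (V : finType) (H : sgraph V) : nat :=
  ex_family n [:: FinGraph H].

(* Main.v *)
Require Import Defs.
From mathcomp Require Import all_boot.
From mathcomp Require Import zify.

Set Implicit Arguments.
Unset Strict Implicit.
Unset Printing Implicit Defensive.

(** Write [t = k - 1], [w = r - 1], [h = k./2].  Since [h <= w], a block of at
    most [t] vertices has at most [2 w] of them, so its Turan graph without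
    [K_r] is a complete graph minus a matching and the Turan numbers are
    explicit: [turan w s].  Two graphs are free of both [K_r] and [P_k]: the
    disjoint union of Turan graphs on blocks of [t] vertices, and, for even
    [k], the graph in which [h - 1] hub vertices are joined to everything
    (a path visits at most [h - 1] hubs and hence at most [h] other vertices).

    For the upper bound, both candidate values are superadditive, in the mixed
    case because the block value lies below the line of slope [h - 1] when [k]
    is even ([turan_blocks_le_linear]).  So it is enough to bound a connected
    graph [G] on [m >= k] vertices ([edge_bound]).  Following Kopylov, add edges
    to [G], disregarding [K_r], until any further edge would create [P_k]; call
    the result [F], and delete vertices of degree less than [h] one by one.

    - If nothing remains, [G] has at most as many edges as the hub graph, which
      for odd [k] is at most the block value.
    - Otherwise a core [C] of minimum degree at least [h] remains.  In [F] the
      core is a clique, and deleting instead the vertices of degree at most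
      [k - 1 - s], where [s] is the size of [C], leaves exactly [C].  Both facts
      are instances of [dense_sets_joined]: in a saturated connected graph, two
      sets of inner minimum degrees [a] and [b] with [k <= a + b + 1] are
      completely joined.  Now [G] has at most [turan w s] edges inside [C], as
      it has no [K_r], and at most [k - 1 - s] further edges per vertex outside;
      this is at most the block value ([turan_core_bound]).

    The joining lemma is a rotation argument.  If [x] and [y] were not adjacent,
    saturation would give two disjoint paths that start at [x] and at [y] and
    have [k] vertices together; through an extra vertex adjacent to everything
    they form one path from [x] to [y].  Take it as long as possible, so that
    it contains the neighbours of both ends.  If the neighbourhoods of the ends
    cross on it, it closes into a cycle of length greater than [k]
    ([exists_long_cycle]); if they do not, each half contains a cycle through
    its end, and connectivity chains the two cycles ([join_cycles]).  In either
    case there is a [P_k] ([long_link_path]). *)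

(** * Turan numbers of small order and their block sums *)

(** The Turan number of [K_(w+1)] on [s <= 2 w] vertices: the parts of the Turan
    graph then have at most two vertices, and exactly [s - w] of them have two. *)
Definition turan (w s : nat) := 'C(s, 2) - (s - w).

(** The edge number of the disjoint union of Turan graphs on [t] vertices each
    and of one Turan graph on the remaining vertices. *)
Definition turan_blocks (t w n : nat) :=
  n %/ t * turan w t + turan w (n %% t).

Lemma bin2D a b : 'C(a + b, 2) = 'C(a, 2) + 'C(b, 2) + a * b.
Proof.
elim: b => [|b IH]; first by rewrite addn0 bin0n muln0 !addn0.
rewrite addnS !binS !bin1 IH mulnS; lia.
Qed.

Lemma turanK w s : 0 < w -> turan w s + (s - w) = 'C(s, 2).
Proof.
move=> w0; rewrite /turan subnK //.
case: s => // s; rewrite binS bin1; lia.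
Qed.

Lemma turan0 w : turan w 0 = 0.
Proof. by []. Qed.

Lemma turan_blocks_small t w s : 0 < t -> s <= t -> turan_blocks t w s = turan w s.
Proof.
move=> t0; rewrite /turan_blocks leq_eqVlt => /predU1P[->|st].
  by rewrite divnn t0 mul1n modnn turan0 addn0.
by rewrite divn_small // modn_small.
Qed.

Lemma turan_blocksDl t w n :
  0 < t -> turan_blocks t w (t + n) = turan w t + turan_blocks t w n.
Proof.
by move=> t0; rewrite /turan_blocks modnDl divnDl // divnn t0 mulnDl mul1n addnA.
Qed.

Lemma turan_superadd w a b : 0 < w -> turan w a + turan w b <= turan w (a + b).
Proof.
move=> w0; have := bin2D a b.
have := turanK a w0; have := turanK b w0; have := turanK (a + b) w0.
case: a => [|a]; case: b => [|b]; rewrite ?turan0 //= ?add0n ?addn0 //.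
nia.
Qed.

(** Convexity: two partial blocks that overflow a full one gain edges when one
    of them is filled up from the other.  The gain of at least one edge per moved
    vertex pays for the non-edges that appear in the full block. *)
Lemma turan_shift w t a b : 0 < w -> a < t -> b < t -> t <= a + b ->
  turan w a + turan w b <= turan w t + turan w (a + b - t).
Proof.
move=> w0 at_ bt tab.
have [c cE] : exists c, t = a + c by exists (t - a); lia.
have [d dE] : exists d, b = c + d by exists (b - c); lia.
have -> : a + b - t = d by lia.
have := bin2D a c; have := bin2D c d; rewrite -cE -dE.
have := turanK a w0; have := turanK b w0; have := turanK t w0; have := turanK d w0.
have : c * d.+1 <= c * a by rewrite leq_mul2l; apply/orP; right; lia.
nia.
Qed.

(** Allows the block bound to be summed over the components of a graph. *)
Lemma turan_blocks_superadd t w a b : 0 < w -> 0 < t ->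
  turan_blocks t w a + turan_blocks t w b <= turan_blocks t w (a + b).
Proof.
move=> w0 t0; rewrite /turan_blocks divnD // modnD // !mulnDl.
have a_lt := ltn_pmod a t0; have b_lt := ltn_pmod b t0.
case: (leqP t (a %% t + b %% t)) => [ge_t|lt_t].
  by rewrite !mul1n addnACA -!addnA !leq_add2l turan_shift.
by rewrite !mul0n addn0 subn0 addnACA leq_add2l turan_superadd.
Qed.

(** For even [k] we have [t = k - 1 = 2 d + 1] with [d = k./2 - 1] hubs.  The
    hub graph gains [d] edges per vertex and the block value at most that many, so
    components of block type can be absorbed into the bound for one of hub type. *)
Lemma turan_blocks_le_linear t d w n : 0 < t -> t = d.*2.+1 -> turan_blocks t w n <= d * n.
Proof.
move=> t0 tE; have turan_le s : s <= t -> turan w s <= d * s.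
  move=> st; apply: leq_trans (leq_subr _ _) _.
  rewrite bin2 leq_half_double -muln2; case: s st => //= s; nia.
rewrite /turan_blocks {3}(divn_eq n t) mulnDr leq_add //; last first.
  by rewrite turan_le // ltnW // ltn_pmod.
by rewrite mulnCA leq_mul2l turan_le // orbT.
Qed.

Lemma bin2_double n : 'C(n, 2) * 2 + n = n * n.
Proof. by elim: n => // n IH; rewrite binS bin1; nia. Qed.

Lemma bin2_ge_pred n : n.-1 <= 'C(n, 2).
Proof. by case: n => // n; rewrite binS bin1 leq_addl. Qed.

(** The convex function ['C(q, 2)] meets the line [j * q - 'C(j + 1, 2)] at [j]
    and at [j + 1]; the correction [q - w] only sets in beyond [w >= j + 1],
    where the parabola already lies above the line by at least that amount. *)
Lemma turan_tangent w j q : j < w -> j * q <= turan w q + 'C(j.+1, 2).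
Proof.
move=> jw; have := turanK q (leq_ltn_trans (leq0n _) jw).
case: (leqP q j) => qj.
  have [d ->] : exists d, j = q + d by exists (j - q); lia.
  rewrite -addnS bin2D; have := bin2_double q; nia.
have [d dE] : exists d, q = j + d by exists (q - j); lia.
have := bin2D j d; rewrite -dE binS bin1.
have := bin2_double j; have := bin2_ge_pred d; nia.
Qed.

Lemma turan_blocks_tangent t w j n : t <= w.*2 -> j.+1.*2 <= t ->
  j * n <= turan_blocks t w n + 'C(j.+1, 2).
Proof.
move=> tw jt; have jw : j < w by lia.
have full : j * t <= turan w t.
  have := turanK t (leq_ltn_trans (leq0n _) jw); have := bin2_double t; nia.
rewrite /turan_blocks {1}(divn_eq n t) mulnDr -addnA leq_add ?turan_tangent //.
by rewrite mulnCA leq_mul2l full orbT.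
Qed.

(** A core of [s] vertices with [j] edges for each vertex outside it.  Completing
    the core to a block of [t] vertices adds [s * j + 'C(j, 2)] edges minus at most
    [j], and the vertices beyond that block are handled by the tangent line of
    slope [j]; the comparison amounts to [j + 2 <= s] when [j > 0]. *)
Lemma turan_core_bound t w s j m : t <= w.*2 -> s + j = t -> j.+1.*2 <= t -> t <= m ->
  turan w s + j * (m - s) <= turan_blocks t w m.
Proof.
move=> tw sjt jt tm; have w0 : 0 < w by lia.
have [m' ->] : exists m', m = t + m' by exists (m - t); lia.
rewrite turan_blocksDl; last lia.
have := turan_blocks_tangent m' tw jt.
have -> : t + m' - s = j + m' by lia.
have := turanK s w0; have := turanK t w0.
have := bin2D s j; rewrite sjt binS bin1; have := bin2_double j.
case: j sjt jt => [|j] sjt jt; first by rewrite mul0n; nia.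
have : j.+1 * j.+3 <= s * j.+1 by rewrite mulnC leq_mul2r; apply/orP; right; lia.
nia.
Qed.

(** * Crossing neighbourhoods close a path into a cycle *)

(** In the application [A] and [B] mark the neighbours of the two ends of a path
    along that path: without a [B] directly followed by an [A], the sum grows by at
    most one per position. *)
Lemma sum_no_consecutive (A B : nat -> bool) m n :
  (forall i, m <= i < m + n -> ~~ (B i && A i.+1)) ->
  \sum_(m <= i < (m + n).+1) (A i + B i) <= A m + n + B (m + n).
Proof.
elim: n => [|n IH] noBA; first by rewrite !addn0 big_nat1.
rewrite addnS big_nat_recr; last lia.
have /IH sum_le i : m <= i < m + n -> ~~ (B i && A i.+1) by move=> ?; apply: noBA; lia.
have := noBA (m + n); rewrite leq_addr addnS ltnSn => /(_ isT).
move: sum_le; case: (B (m + n)); case: (A (m + n).+1) => //=; lia.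
Qed.

Lemma last_drop (T : Type) (x : T) j z : j < size z -> last x (drop j z) = last x z.
Proof.
by move=> jz; rewrite -[in RHS](cat_take_drop j z) last_cat (drop_nth x jz).
Qed.

Section Cycles.
Variables (T : eqType) (e : rel T).
Hypothesis e_sym : symmetric e.

Lemma sorted_rev_sym (s : seq T) : sorted e (rev s) = sorted e s.
Proof. by rewrite rev_sorted; apply: eq_sorted => a b; rewrite e_sym. Qed.

(** Follow the path from its first vertex to position [i], jump to its last
    vertex, go back to position [j], and jump to the first vertex. *)
Lemma cycle_crossing x z i j (s := x :: z) (y := last x z) :
  path e x z -> i < j < size s -> e y (nth x s i) -> e x (nth x s j) ->
  cycle e (take i.+1 s ++ rev (drop j s)).
Proof.
move=> xz /andP[ij js] yi xj.
have iz : i <= size z by move: js; rewrite /s /=; lia.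
rewrite /= rcons_cat cat_path take_path //=.
rewrite (last_nth x) size_takel // -[x :: take i z]/(take i.+1 s) nth_take //.
set a := nth x s i; set d := drop j s.
have -> : path e a (rcons (rev d) x) = sorted e (rev (rcons (x :: d) a)).
  by rewrite rev_rcons rev_cons.
have js' : j <= size z by move: js; rewrite /s /=; lia.
have j0 : 0 < j by lia.
have d_last : last x d = y.
  by rewrite /d /s; case: j j0 js' {ij js xj d} => // j _ jz; apply: last_drop.
rewrite sorted_rev_sym /= rcons_path d_last yi andbT /d (drop_nth x js) /= xj /=.
have := @drop_sorted _ e j s xz; rewrite (drop_nth x js) //.
Qed.

Lemma count_sum (a : pred T) (x0 : T) (s : seq T) :
  count a s = \sum_(0 <= i < size s) a (nth x0 s i).
Proof. by rewrite -sum1_count (big_nth x0) big_mkcond. Qed.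

Hypothesis e_irr : irreflexive e.


(** Posa's argument.  Take a crossing pair with the smallest gap.  If it is
    consecutive, the cycle uses the whole path; otherwise no neighbour of an end
    lies in the gap, and no two consecutive positions cross on either side, so
    what is kept is at least the sum of the two degrees. *)
Lemma exists_long_cycle x0 s (x := head x0 s) (y := last x0 s) i j :
    uniq s -> sorted e s ->
    i < j < size s -> e y (nth x0 s i) -> e x (nth x0 s j) ->
  exists c, [/\ uniq c, cycle e c &
    minn (size s) (count (e x) s + count (e y) s) <= size c].
Proof.
move=> s_uniq s_path ij yi xj.
have x_first : e x (nth x0 s 0) = false by rewrite nth0 e_irr.
have y_last : e y (nth x0 s (size s).-1) = false by rewrite nth_last e_irr.
have crossing_cycle k l : k < l < size s -> e y (nth x0 s k) -> e x (nth x0 s l) ->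
    cycle e (take k.+1 s ++ rev (drop l s)).
  move=> kl; have [ks ls] : k < size s /\ l < size s by split; lia.
  rewrite (set_nth_default (head x0 s) x0 ks) (set_nth_default (head x0 s) x0 ls).
  by case: (s) s_path @x @y kl {ij yi xj x_first y_last ks ls} => [|a s'] //=;
    rewrite ?andbF //; apply: cycle_crossing.
clearbody x y.
pose crossed g := [exists i : 'I_(size s),
  [&& 0 < g, i + g < size s, e y (nth x0 s i) & e x (nth x0 s (i + g))]].
have ex_crossed : exists g, crossed g.
  have i_lt : i < size s by lia.
  exists (j - i); apply/existsP; exists (Ordinal i_lt) => /=.
  by case/andP: ij => ij js; rewrite subnKC ?(ltnW ij) // yi xj subn_gt0 ij js.
case: (ex_minnP ex_crossed) => g.
case/existsP => [[{yi ij}i /= i_lt] /and4P[g0 ig yi xig]] g_min.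
have {}g_min k l : k < l < size s -> e y (nth x0 s k) -> e x (nth x0 s l) -> g <= l - k.
  move=> kl yk xl; apply: g_min; have k_lt : k < size s by lia.
  apply/existsP; exists (Ordinal k_lt) => /=; case/andP: kl => kl ls.
  by rewrite subnKC ?(ltnW kl) // yk xl subn_gt0 kl ls.
have ij : i < i + g < size s by lia.
exists (take i.+1 s ++ rev (drop (i + g) s)); split.
- rewrite cat_uniq rev_uniq take_uniq ?drop_uniq //= andbT has_rev.
  have : subseq (take i.+1 s ++ drop (i + g) s) s.
    rewrite -[s in subseq _ s](cat_take_drop i.+1) cat_subseq //.
    have -> : i + g = g.-1 + i.+1 by lia.
    by rewrite -drop_drop drop_subseq.
  by move/subseq_uniq => /(_ s_uniq); rewrite cat_uniq => /and3P[].
- exact: crossing_cycle.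
rewrite size_cat size_rev size_drop size_takel; last lia.
rewrite geq_min; case: (ltnP 1 g) => g1; last by apply/orP; left; lia.
apply/orP; right.
rewrite !(count_sum _ x0) -big_split /=.
pose A k := e x (nth x0 s k); pose B k := e y (nth x0 s k).
have noBA k : k.+1 < size s -> ~~ (B k && A k.+1).
  move=> ks; apply/negP => /andP[yk xk].
  have := g_min k k.+1; rewrite ltnSn ks => /(_ isT yk xk). by rewrite subSnn; lia.
have gap k : i.+1 <= k < i + g -> A k + B k = 0.
  move=> ik; have := g_min i k; have := g_min k (i + g); rewrite /A /B yi xig.
  case: (e x _); case: (e y _) => //=; lia.
have := @sum_no_consecutive A B 0 i; rewrite add0n.
have := @sum_no_consecutive A B (i + g) ((size s).-1 - (i + g)).
have -> : i + g + ((size s).-1 - (i + g)) = (size s).-1 by lia.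
have -> : (size s).-1.+1 = size s by lia.
have -> : A 0 = false by []; have -> : B (size s).-1 = false by [].
move=> sum2 sum1.
rewrite -[X in X <= _]/(\sum_(0 <= k < size s) (A k + B k)).
rewrite (big_cat_nat (n := i.+1)) //=.
rewrite (big_cat_nat (m := i.+1) (n := i + g)) //=; [|lia..].
have -> : \sum_(i.+1 <= k < i + g) (A k + B k) = 0.
  by rewrite big_nat; apply: big1 => k /gap.
have {}sum1 : \sum_(0 <= k < i.+1) (A k + B k) <= 0 + i + B i.
  by apply: sum1 => k ki; apply: noBA; lia.
have {}sum2 : \sum_(i + g <= k < size s) (A k + B k)
    <= A (i + g) + ((size s).-1 - (i + g)) + 0.
  by apply: sum2 => k ki; apply: noBA; lia.
case: (B i) sum1 => /=; case: (A (i + g)) sum2 => /=; lia.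
Qed.

End Cycles.

(** * Long paths; two disjoint cycles in a connected graph *)

(** A boolean, so that saturated graphs can be chosen by maximization over
    finitely many graphs. *)
Definition has_path (T : finType) (e : rel T) k :=
  [exists s : k.-tuple T, uniq s && sorted e s].

Lemma has_pathP (T : finType) (e : rel T) k :
  reflect (exists s, [/\ uniq s, sorted e s & k <= size s]) (has_path e k).
Proof.
apply: (iffP existsP) => [[s /andP[s_uniq es]]|[s [s_uniq es ks]]].
  by exists s; rewrite size_tuple.
exists (Tuple (introT eqP (size_takel ks))) => /=.
by rewrite take_uniq ?take_sorted.
Qed.

Lemma cycle_open (T : eqType) (e : rel T) (c : seq T) u : uniq c -> cycle e c -> u \in c ->
  exists p, [/\ path e u p, uniq (u :: p), u :: p =i c & size (u :: p) = size c].
Proof.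
move=> c_uniq ec /rot_to[i p rotE]; exists p.
have: cycle e (rot i c) by rewrite rot_cycle.
rewrite rotE /= rcons_path => /andP[-> _]; split => //.
- by rewrite -[_ && _]/(uniq (u :: p)) -rotE rot_uniq.
- by move=> x; rewrite -rotE mem_rot.
- by rewrite -[_.+1]/(size (u :: p)) -rotE size_rot.
Qed.

Section Join.
Variables (T : finType) (e : rel T).
Hypothesis e_sym : symmetric e.

(** A path between the two cycles, cut at its first vertex on the second
    cycle and then at its last vertex on the first one, meets each cycle only at
    an end; both cycles can then be traversed completely. *)
Lemma join_cycles c1 c2 x y :
    uniq c1 -> uniq c2 -> cycle e c1 -> cycle e c2 -> ~~ has (mem c1) c2 ->
    x \in c1 -> y \in c2 -> connect e x y -> has_path e (size c1 + size c2).
Proof.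
move=> c1_uniq c2_uniq ec1 ec2 dis x1 y2 /connectP[p0 exp0 yE].
rewrite yE in y2; case/shortenP: exp0 y2 => p exp p_uniq _ y2 {p0 yE}.
have : has (mem c2) (x :: p) by apply/hasP; exists (last x p); rewrite ?mem_last.
have {exp} : sorted e (x :: p) by [].
have : forall a, head a (x :: p) = x by [].
move: (x :: p) p_uniq => s s_uniq s_head es hs.
case/split_find: hs s_head s_uniq es => v s1 s2 /= v2 s1N2 s_head.
rewrite cat_uniq => /andP[s1_uniq _] /cat_sorted2[es1 _].
have : has (mem c1) (rev (rcons s1 v)).
  apply/hasP; exists x => //; rewrite mem_rev -(s_head v).
  by case: (s1) => [|a s'] /=; rewrite mem_head.
have vN1 : v \notin c1 by apply: contra dis => v1; apply/hasP; exists v.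
rewrite -sorted_rev_sym // in es1; rewrite -rev_uniq in s1_uniq.
have s1N2' a : a \in s1 -> a \notin c2.
  by apply: contraL => a2; apply: contra s1N2 => ?; apply/hasP; exists a.
rewrite rev_rcons in es1 s1_uniq *.
have {s1N2'} : {in rev s1, forall a, a \notin c2} by move=> a; rewrite mem_rev => /s1N2'.
move=> tN2; rewrite [has _ _]/= (negPf vN1) /= => ht.
case/split_find: ht tN2 es1 s1_uniq => u t1 t2 /= u1 t1N1 tN2.
rewrite cat_path /= cat_uniq => /andP[vt1 _] /andP[_ /andP[t1_uniq _]].
have [p1 [up1 p1_uniq p1E p1_size]] := cycle_open c1_uniq ec1 u1.
have [p2 [vp2 p2_uniq p2E p2_size]] := cycle_open c2_uniq ec2 v2.
have t1N2 a : a \in t1 -> a \notin c2.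
  by move=> at1; apply: tN2; rewrite mem_cat mem_rcons inE at1 orbT.
apply/has_pathP; exists (rev (v :: p2) ++ (t1 ++ u :: p1)); split.
- rewrite cat_uniq rev_uniq p2_uniq cat_uniq p1_uniq !andbT.
  move: t1_uniq; rewrite rcons_uniq => /andP[_ ->]; rewrite !andTb; apply/andP; split.
    apply/hasPn => a; rewrite mem_cat !mem_rev p2E p1E => /orP[/t1N2 //|a1].
    by apply: contra dis => a2; apply/hasP; exists a.
  by apply: contra t1N1 => /hasP[a]; rewrite p1E => a1 at1; apply/hasP; exists a.
- rewrite rev_cons cat_rcons sorted_cat_cons -rev_cons sorted_rev_sym //.
  by rewrite -cat_rcons cat_path vt1 last_rcons up1 !andbT.
- rewrite size_cat size_rev p2_size size_cat p1_size.
  by rewrite addnCA (addnC (size c2)) leq_addl.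
Qed.
End Join.

(** * Adding a dominating vertex *)

Lemma has_path_le (T : finType) (e : rel T) k l : k <= l -> has_path e l -> has_path e k.
Proof.
move=> kl /has_pathP[s [us es ls]]; apply/has_pathP; exists s; split=> //.
exact: leq_trans ls.
Qed.

(** Through the added vertex [None], a path of the graph becomes a cycle with one
    more vertex, and two disjoint paths become a single one. *)
Definition apex (T : Type) (e : rel T) : rel (option T) := fun a b =>
  match a, b with
  | Some x, Some y => e x y
  | None, None => false
  | _, _ => true
  end.

Lemma map_Some_pmap (T : eqType) (p : seq (option T)) :
  None \notin p -> map Some (pmap id p) = p.
Proof. by elim: p => [|[x|] p IH] //=; rewrite inE => /= /IH->. Qed.

Section Apex.
Variables (T : finType) (e : rel T).
Hypothesis (e_sym : symmetric e) (e_irr : irreflexive e).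

Lemma apex_sym : symmetric (apex e).
Proof. by move=> [x|] [y|] //=. Qed.

Lemma apex_irr : irreflexive (apex e).
Proof. by move=> [x|] //=. Qed.

Lemma apex_path k p : uniq p -> sorted (apex e) p -> None \notin p -> k <= size p ->
  has_path e k.
Proof.
move=> + + /map_Some_pmap pE; rewrite -pE (map_inj_uniq Some_inj) sorted_map size_map => us es ks.
by apply/has_pathP; exists (pmap id p).
Qed.

(** The cycle passes through the apex at most once; cut it there. *)
Lemma apex_cycle k c : uniq c -> cycle (apex e) c -> k < size c -> has_path e k.
Proof.
move=> uc ec kc; have [Nc|Nc] := boolP (None \in c); last first.
  by apply: (apex_path uc _ Nc (ltnW kc)); case: c ec {uc kc Nc} => //= a c;
    rewrite rcons_path => /andP[].
have [p [ep up pE p_size]] := cycle_open uc ec Nc.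
case/andP: up => Np up; apply: (apex_path up _ Np); last by rewrite -p_size in kc.
exact: path_sorted ep.
Qed.

(** Close the path at the last neighbour of its first vertex: the cycle contains
    the first vertex and all of its neighbours on the path. *)
Lemma end_cycle x s a : uniq (x :: s) -> path e x s -> a <= count (e x) s -> 0 < a ->
  exists c, [/\ uniq c, cycle e c, x \in c, {subset c <= x :: s} & a < size c].
Proof.
move=> us es as_ a0.
have: has (e x) (rev s) by rewrite has_rev has_count (leq_trans a0).
move sE: (rev s) => s' hs'; case/split_find: hs' sE => u t1 t2 xu t1N sE.
have {}sE : s = rcons (rev t2) u ++ rev t1.
  by rewrite -(revK s) sE rev_cat rev_rcons cat_rcons.
move: us es as_; rewrite sE cat_path -cat_cons cat_uniq count_cat count_rev.
have -> : count (e x) t1 = 0 by apply/eqP; rewrite -leqn0 leqNgt -has_count.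
rewrite addn0 => /andP[us _] /andP[es _] as_.
exists (x :: rcons (rev t2) u); split => //.
- by rewrite /= rcons_path es last_rcons e_sym.
- by rewrite mem_head.
- by move=> b bs; rewrite mem_cat bs.
- by apply: leq_ltn_trans as_ _; rewrite ltnS count_size.
Qed.

(** The counts of neighbours include the apex, so a crossing gives a cycle of
    more than [k] vertices.  As the apex is adjacent to both ends, without a
    crossing all neighbours of each end lie on its own side of the apex. *)
Lemma long_link_path k a b x y z :
    uniq z -> sorted (apex e) z -> head None z = Some x -> last None z = Some y ->
    k < size z -> a < count (apex e (Some x)) z -> b < count (apex e (Some y)) z ->
    0 < a -> 0 < b -> k <= (a + b).+1 -> connect e x y ->
  has_path e k.
Proof.
move=> uz ez zx zy kz az bz a0 b0 kab xy.
have [Nz|Nz] := boolP (None \in z); last by apply: (apex_path uz ez Nz); apply: ltnW.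
pose crossed := [exists i : 'I_(size z), exists j : 'I_(size z),
  [&& i < j, apex e (Some y) (nth None z i) & apex e (Some x) (nth None z j)]].
have [|noX] := boolP crossed.
  case/existsP => i /existsP[j /and3P[ij yi xj]].
  have [|||c [uc ec cz]] := @exists_long_cycle _ _ apex_sym apex_irr None z i j uz ez.
  - by rewrite ij ltn_ord.
  - by rewrite zy.
  - by rewrite zx.
  apply: (apex_cycle uc ec); apply: leq_trans cz; rewrite zx zy leq_min kz andTb.
  by apply: leq_trans (leq_add az bz); lia.
have {}noX i j : i < j < size z -> apex e (Some y) (nth None z i) ->
    apex e (Some x) (nth None z j) -> False.
  move=> /andP[ij jz] yi xj; case/negP: noX; apply/existsP.
  exists (Ordinal (ltn_trans ij jz)); apply/existsP; exists (Ordinal jz).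
  exact/and3P.
case/splitPr: Nz uz ez zx zy kz az bz noX => A B uz ez zx zy kz az bz noX.
have xB : count (apex e (Some x)) B = 0.
  apply/eqP; rewrite -leqn0 leqNgt -has_count; apply/negP => /(has_nthP None)[i iB xi].
  apply: (noX (size A) (size A + i.+1)).
  - rewrite size_cat /=; lia.
  - by rewrite nth_cat ltnn subnn.
  - by rewrite nth_cat ltnNge leq_addr addKn.
have yA : count (apex e (Some y)) A = 0.
  apply/eqP; rewrite -leqn0 leqNgt -has_count; apply/negP => /(has_nthP None)[i iA yi].
  apply: (noX i (size A)).
  - rewrite size_cat /=; lia.
  - by rewrite nth_cat iA.
  - by rewrite nth_cat ltnn subnn.
move: az bz; rewrite !count_cat /= xB yA addn0 add0n !add1n addn1 !ltnS => xA yB.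
move: uz; rewrite cat_uniq => /and3P[uA dis].
rewrite cons_uniq => /andP[NB uB].
have NA : None \notin A by apply: contra dis => NA; apply/hasP; exists None; rewrite ?mem_head.
case/cat_sorted2: ez => eA; rewrite -cat1s => /cat_sorted2[_ eB].
have {}dis : ~~ has (mem A) B by apply: contra dis => h; rewrite /= h orbT.
move: zx; rewrite last_cat /= in zy.
move: uA eA xA dis uB eB yB zy; rewrite -(map_Some_pmap NA) -(map_Some_pmap NB).
move: (pmap id A) (pmap id B) => {NA NB kz noX xB yA} {}A {}B.
rewrite !(map_inj_uniq Some_inj) !sorted_map !count_map.
move=> uA eA xA dis uB eB yB zy zx.
case: A uA eA xA dis zx => [|x' A] // uA eA xA dis [xE]; rewrite {x'}xE in uA eA xA dis.
case/lastP: B uB eB yB zy dis => [|B y'] // uB eB yB.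
rewrite map_rcons last_rcons => -[yE]; rewrite {y'}yE in uB eB yB * => dis.
have [||c1 [uc1 ec1 xc1 c1A ac1]] := @end_cycle x A a uA eA.
- by move: xA; rewrite /= e_irr.
- by [].
have [|||| c2 [uc2 ec2 yc2 c2B bc2]] := @end_cycle y (rev B) b.
- by rewrite -rev_rcons rev_uniq.
- by move: eB; rewrite -sorted_rev_sym // rev_rcons.
- by move: yB; rewrite -count_rev rev_rcons /= e_irr.
- by [].
have c12 : ~~ has (mem c1) c2.
  apply: contra dis => /hasP[v /c2B v2 /c1A v1]; apply/hasP; exists (Some v).
    by rewrite -map_rcons map_f // -[rcons B y]revK mem_rev rev_rcons.
  exact: map_f v1.
apply: has_path_le (join_cycles e_sym uc1 uc2 ec1 ec2 c12 xc1 yc2 xy).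
by apply: leq_trans kab _; apply: leq_trans (leq_add ac1 bc2); rewrite addSn addnS.
Qed.

End Apex.

(** * Dense sets in path-saturated graphs *)

Lemma first_nonstep (T : Type) (e : rel T) s : ~~ sorted e s ->
  exists s1 u v s2, [/\ s = s1 ++ u :: v :: s2, sorted e (rcons s1 u) & ~~ e u v].
Proof.
elim: s => // x [|v p] IH //=; rewrite negb_and.
have [exv /= /IH[s1 [u [w [s2 [pE es1 uw]]]]]|xv _] := boolP (e x v); last first.
  by exists [::], x, v, p.
exists (x :: s1), u, w, s2; rewrite pE; split=> //=.
by case: s1 pE es1 => [|a s1] [<- _] /=; rewrite exv.
Qed.

Definition adj (V : finType) (E : {set {set V}}) : rel V :=
  fun x y => [set x; y] \in E.

Lemma adj_sym (V : finType) (E : {set {set V}}) : symmetric (adj E).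
Proof. by move=> x y; rewrite /adj setUC. Qed.

Definition inner_deg (V : finType) (E : {set {set V}}) (X : {set V}) x :=
  #|[set y in X | adj E x y]|.

Lemma set2_inj (V : finType) (x y u v : V) : [set u; v] = [set x; y] -> u != v ->
  (u = x /\ v = y) \/ (u = y /\ v = x).
Proof.
move=> uvxy uv; have : u \in [set x; y] by rewrite -uvxy set21.
have : v \in [set x; y] by rewrite -uvxy set22.
rewrite !inE => /pred2P[] vE /pred2P[] uE; subst; rewrite ?eqxx in uv => //; by [left|right].
Qed.

Section Saturated.
Variables (V : finType) (E : {set {set V}}).
Hypothesis E2 : {in E, forall e : {set V}, #|e| = 2}.

Lemma adj_irr : irreflexive (adj E).
Proof. by move=> x; apply/negP => /E2; rewrite setUid cards1. Qed.

Definition link x y z := [/\ uniq z, sorted (apex (adj E)) z,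
  head None z = Some x & last None z = Some y].

Lemma link_rev x y z : link x y z -> link y x (rev z).
Proof.
move=> [uz ez zx zy]; split.
- by rewrite rev_uniq.
- by rewrite sorted_rev_sym //; apply/apex_sym/adj_sym.
- by rewrite -zy; case/lastP: (z) => // s v; rewrite rev_rcons last_rcons.
- by rewrite -zx; case: (z) => // v s; rewrite rev_cons last_rcons.
Qed.

(** A path that exists only thanks to the edge [xy] uses that edge exactly once;
    remove the edge and reconnect the outer ends through the apex. *)
Lemma saturated_link k x y :
    ~~ has_path (adj E) k -> has_path (adj ([set x; y] |: E)) k ->
  exists2 z, link x y z & k < size z.
Proof.
move=> noP /has_pathP[s [us es ks]].
have [|s1 [u [v [s2 [sE es1 uv]]]]] := @first_nonstep _ (adj E) s.
  by apply: contra noP => es'; apply/has_pathP; exists s.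
subst s; move: es; rewrite sorted_cat_cons /= => /andP[_ /andP[uv' es2]].
move: uv'; rewrite /adj !inE [_ \in E](negPf uv) orbF => /eqP uvxy.
move: us; rewrite cat_uniq /= => /and3P[us1 us12 /andP[uNs2 us2]].
have uv_neq : u != v by move: uNs2; rewrite inE negb_or => /andP[].
have {}es2 : path (adj E) v s2.
  apply: (@sub_in_path _ (predC1 u)) es2; last first.
    by apply/allP => a avs /=; apply: contraNneq uNs2 => <-.
  move=> p q pu qu; rewrite /adj !inE -uvxy => /orP[/eqP pq|//].
  have := set21 u v; rewrite -pq !inE => /pred2P[] uE.
    by move: pu; rewrite -uE inE /= eqxx.
  by move: qu; rewrite -uE inE /= eqxx.
have {us12} dis : ~~ has (mem s1) (u :: v :: s2) by [].
pose z := map Some (rev (rcons s1 u)) ++ None :: map Some (rev (v :: s2)).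
have zlink : link u v z.
  split.
  - have us2' : uniq (v :: s2) by [].
    have NSome (p : seq V) : None \notin map Some p by apply/negP => /mapP[].
    rewrite /z cat_uniq cons_uniq !(map_inj_uniq Some_inj) !rev_uniq us2' rcons_uniq us1.
    rewrite NSome !andbT; apply/andP; split.
      by apply: contra dis => us; apply/hasP; exists u; rewrite ?mem_head.
    apply/hasPn => a; rewrite inE => /predU1P[->|]; first exact: NSome.
    case/mapP => {}a + ->; rewrite mem_rev => avs.
    apply/negP => /mapP[a' + [aE]]; rewrite -aE mem_rev mem_rcons inE.
    case/predU1P => [au|as1]; first by move: uNs2; rewrite -au avs.
    move: dis; apply/negP; rewrite negbK.
    by apply/hasP; exists a => //; rewrite inE avs orbT.
  - rewrite /z sorted_cat_cons; apply/andP; split.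
      rewrite -sorted_rev_sym; last exact/apex_sym/adj_sym.
      by rewrite (rev_rcons (map _ _)) -map_rev revK /=; case: s1 {us1 dis ks z} es1 => //= a s1 es1;
        rewrite path_map.
    have : sorted (adj E) (rev (v :: s2)) by rewrite sorted_rev_sym //; apply: adj_sym.
    by case: (rev _) => //= a s; rewrite path_map.
  - by rewrite /z rev_rcons.
  - by rewrite /z last_cat /= rev_cons map_rcons last_rcons.
have z_size : k < size z.
  apply: leq_ltn_trans ks _.
  by rewrite /z !size_cat /= !size_map !size_rev size_rcons /= !addnS ltnSn.
have [[uE vE]|[uE vE]] := set2_inj uvxy uv_neq; subst; first by exists z.
by exists (rev z); rewrite ?size_rev //; apply: link_rev.
Qed.

(** The strict inequality comes from the apex, which is a further neighbour. *)
Lemma inner_deg_count (X : {set V}) x z : None \in z ->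
    {in X, forall x', adj E x x' -> Some x' \in z} ->
  inner_deg E X x < count (apex (adj E) (Some x)) z.
Proof.
move=> Nz Xz; pose N := [set y in X | adj E x y].
rewrite -size_filter /inner_deg -/N cardE.
have -> : (size (enum N)).+1 = size (None :: map Some (enum N)) by rewrite /= size_map.
apply: uniq_leq_size.
  rewrite /= (map_inj_uniq Some_inj) enum_uniq andbT.
  by apply/negP => /mapP[].
move=> a; rewrite inE mem_filter => /predU1P[->|/mapP[v + ->]]; first by rewrite Nz.
by rewrite mem_enum inE => /andP[vX xv]; rewrite /= xv Xz.
Qed.

(** A neighbour of [x] off the path can be put in front of it.  If it is also
    adjacent to [y], this closes a cycle that is too long. *)
Lemma link_extend x y z v k : link x y z -> k < size z -> adj E x v -> Some v \notin z ->
  has_path (adj E) k \/ [/\ v != y, ~~ adj E v y & link v y (Some v :: z)].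
Proof.
move=> [uz ez zx zy] kz xv vz.
have vz_path : path (apex (adj E)) (Some v) z.
  by case: z {uz kz vz zy} ez zx => //= a z + [aE]; rewrite aE /= adj_sym xv.
have [vy|vy] := boolP (adj E v y); [left|right].
  apply: (@apex_cycle _ (adj E) k (Some v :: z)); rewrite /= ?vz //; last exact: leqW.
  rewrite rcons_path vz_path /=.
  suff -> : last (Some v) z = Some y by rewrite /= adj_sym.
  by case: z zy {uz ez zx kz vz vz_path}.
split => //; last first.
  split; rewrite /= ?vz //.
  by case: z zy {uz ez zx kz vz vz_path}.
apply: contraNneq vz => ->; rewrite -zy.
by case: z kz {uz ez zx zy vz_path} => // a z _; rewrite /= mem_last.
Qed.

(** By induction on the number of vertices off the link, that is, for a longest
    link between non-adjacent vertices of [X] and [Y]: a neighbour of an end inside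
    its own set would extend the link unless it already lies on it, so
    [long_link_path] applies. *)
Lemma dense_sets_joined k a b (X Y : {set V}) :
    {in X & Y, forall x y, connect (adj E) x y} ->
    {in X & Y, forall x y, x != y -> ~~ adj E x y -> has_path (adj ([set x; y] |: E)) k} ->
    {in X, forall x, a <= inner_deg E X x} -> {in Y, forall y, b <= inner_deg E Y y} ->
    0 < a -> 0 < b -> k <= (a + b).+1 -> ~~ has_path (adj E) k ->
  {in X & Y, forall x y, x != y -> adj E x y}.
Proof.
move=> con sat aX bY a0 b0 kab noP x y xX yY xy; apply: contraR noP => nxy.
apply: contraT => noP.
have [z zl kz] := saturated_link noP (sat x y xX yY xy nxy).
move: noP; apply: contraNT => _.
(* Induction on the room left for a longer link. *)
have [n] := ubnP (#|{: option V}| - size z).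
elim: n => // n IH in x y z xX yY xy nxy zl kz *; rewrite ltnS => zn.
have [//|noP] := boolP (has_path (adj E) k).
have grow z' x' y' : size z' = (size z).+1 -> link x' y' z' -> x' \in X -> y' \in Y ->
    x' != y' -> ~~ adj E x' y' -> has_path (adj E) k.
  move=> z'z z'l x'X y'Y x'y' nx'y'; apply: (IH x' y' z') => //; first by rewrite z'z ltnW.
  have : size z' <= #|{: option V}|.
    by have [uz' _ _ _] := z'l; rewrite -(card_uniqP uz') max_card.
  by rewrite z'z; lia.
have [uz ez zx zy] := zl.
have Nz : None \in z.
  by apply: contraNT noP => Nz; apply: apex_path uz ez Nz (ltnW kz).
have Xz : {in X, forall x', adj E x x' -> Some x' \in z}.
  move=> x' x'X xx'; apply: contraNT noP => x'z.
  have [//|[x'y nx'y zl']] := link_extend zl kz xx' x'z.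
  exact: grow zl' x'X yY x'y nx'y.
have Yz : {in Y, forall y', adj E y y' -> Some y' \in z}.
  move=> y' y'Y yy'; apply: contraNT noP => y'z.
  have kz' : k < size (rev z) by rewrite size_rev.
  have y'z' : Some y' \notin rev z by rewrite mem_rev.
  have [//|[y'x ny'x /link_rev zl']] := link_extend (link_rev zl) kz' yy' y'z'.
  apply: grow zl' xX y'Y _ _; rewrite 1?eq_sym 1?adj_sym //.
  by rewrite size_rev /= size_rev.
case/negP: noP.
apply: (long_link_path (adj_sym E) adj_irr uz ez zx zy kz _ _ a0 b0 kab (con x y xX yY)).
  exact: leq_ltn_trans (aX x xX) (inner_deg_count Nz Xz).
exact: leq_ltn_trans (bY y yY) (inner_deg_count Nz Yz).
Qed.

End Saturated.

(** * Peeling off vertices of small degree *)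

Definition inner (V : finType) (E : {set {set V}}) (X : {set V}) :=
  [set e in E | e \subset X].

Definition clique (V : finType) (E : {set {set V}}) (C : {set V}) :=
  [forall x in C, forall y in C, (x != y) ==> adj E x y].

Lemma cliqueP (V : finType) (E : {set {set V}}) (C : {set V}) :
  reflect {in C &, forall x y, x != y -> adj E x y} (clique E C).
Proof.
apply: (iffP forall_inP) => [cl x y xC yC xy|cl x xC].
  by move/forall_inP: (cl x xC) => /(_ y yC); rewrite xy.
by apply/forall_inP => y yC; apply/implyP => xy; apply: cl.
Qed.

Section Peeling.
Variables (V : finType) (E : {set {set V}}).
Hypothesis E2 : {in E, forall e : {set V}, #|e| = 2}.

Lemma inner_le_bin S : #|inner E S| <= 'C(#|S|, 2).
Proof.
rewrite -cards_draws; apply/subset_leq_card/subsetP => e.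
by rewrite !inE => /andP[/E2-> ->].
Qed.

(** The edges lost are the pairs of [v] with its neighbours in [S]. *)
Lemma inner_del S v : #|inner E S :\: inner E (S :\ v)| <= inner_deg E S v.
Proof.
apply: leq_trans (leq_imset_card (fun y => [set v; y]) _).
apply/subset_leq_card/subsetP => e; rewrite !inE => /andP[+ /andP[eE eS]].
rewrite eE /= => neS; have ve : v \in e.
  by apply: contraNT neS => ve; rewrite subsetD1 eS.
have /cards2P[a [b [ab eab]]] : #|e| == 2 by rewrite (E2 eE).
have [y ey] : exists y, e = [set v; y].
  move: ve; rewrite eab !inE => /pred2P[]->; first by exists b.
  by exists a; rewrite setUC.
apply/imsetP; exists y => //; rewrite inE /adj -ey eE andbT.
by apply: (subsetP eS); rewrite ey set22.
Qed.

Lemma inner_le_add S v : #|inner E S| <= #|inner E (S :\ v)| + inner_deg E S v.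
Proof.
rewrite -(cardsID (inner E (S :\ v)) (inner E S)) leq_add ?inner_del //.
by apply/subset_leq_card/subsetIr.
Qed.

Lemma inner_deg_mono (X S : {set V}) x : X \subset S -> inner_deg E X x <= inner_deg E S x.
Proof.
move=> XS; apply/subset_leq_card/subsetP => y; rewrite !inE => /andP[yX ->].
by rewrite (subsetP XS).
Qed.

Definition dense d (X : {set V}) := [forall x in X, d < inner_deg E X x].

(** Delete vertices of inner degree at most [d] as long as there are any.  A
    dense subset is never touched, hence it survives in the core. *)
Lemma peeling d (S : {set V}) : exists C : {set V}, [/\ C \subset S, dense d C,
  #|inner E S :\: inner E C| <= d * (#|S| - #|C|) &
  forall X : {set V}, X \subset S -> dense d X -> X \subset C].
Proof.
have [n] := ubnP #|S|; elim: n S => // n IH S; rewrite ltnS => Sn.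
have [dS|] := boolP (dense d S).
  by exists S; split => //; rewrite setDv cards0.
case/forall_inPn => v vS; rewrite -leqNgt => vd.
have Sv : #|S| = #|S :\ v|.+1 by rewrite (cardsD1 v) vS.
have [|C [CS dC SC maxC]] := IH (S :\ v); first by rewrite -ltnS -Sv.
exists C; split => //.
- exact: subset_trans CS (subD1set _ _).
- rewrite Sv subSn ?subset_leq_card // mulnS; apply: leq_trans (leq_add vd SC).
  apply: leq_trans (leq_add (inner_del S v) (leqnn _)); apply: leq_trans (leq_card_setU _ _).1.
  apply/subset_leq_card/subsetP => e; rewrite !inE.
  by case: (e \in E); case: (e \subset S); case: (e \subset S :\ v); case: (e \subset C).
move=> X XS dX; apply: maxC => //; rewrite subsetD1 XS; apply/negP => vX.
move/forall_inP: dX => /(_ v vX); rewrite ltnNge => /negP; apply.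
exact: leq_trans (inner_deg_mono v XS) vd.
Qed.

(** Deleting stops at [d] vertices, which span at most ['C(d, 2)] edges; with
    [d] edges for each of the others this is the edge number of the hub graph. *)
Lemma degenerate_bound d (S : {set V}) :
    (forall X : {set V}, X \subset S -> dense d X -> X = set0) ->
  d <= #|S| -> #|inner E S| + 'C(d.+1, 2) <= d * #|S|.
Proof.
have [n] := ubnP #|S|; elim: n S => // n IH S; rewrite ltnS => Sn noD.
rewrite leq_eqVlt => /predU1P[dS|dS].
  rewrite -dS; have := inner_le_bin S; rewrite -dS.
  by have := bin2_double d; rewrite binS bin1; lia.
have : ~~ dense d S.
  by apply: contraTN dS => /noD->; rewrite ?cards0.
case/forall_inPn => v vS; rewrite -leqNgt => vd.
have Sv : #|S| = #|S :\ v|.+1 by rewrite (cardsD1 v) vS.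
have le1 := inner_le_add S v.
have : #|inner E (S :\ v)| + 'C(d.+1, 2) <= d * #|S :\ v|.
  apply: IH => [|X XS|]; [by rewrite -Sv | | by rewrite -ltnS -Sv].
  by apply: noD; apply: subset_trans XS (subD1set _ _).
rewrite Sv mulnS; lia.
Qed.

(** While more than [w] vertices are left, some two are not adjacent; deleting
    one of them removes one edge less than a vertex of a clique would. *)
Lemma clique_free_bound w (S : {set V}) : 0 < w -> (forall C : {set V}, clique E C -> #|C| <= w) ->
  #|inner E S| <= turan w #|S|.
Proof.
move=> w0 cl; have [n] := ubnP #|S|; elim: n S => // n IH S; rewrite ltnS => Sn.
have [Sw|Sw] := leqP #|S| w.
  by rewrite /turan (eqP (_ : #|S| - w == 0)) ?subn0 ?inner_le_bin // subn_eq0.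
have : ~~ clique E S by apply: contraTN Sw => /cl; rewrite -leqNgt.
case/forall_inPn => x xS /forall_inPn[y yS]; rewrite negb_imply => /andP[xy nxy].
have Sx : #|S| = #|S :\ x|.+1 by rewrite (cardsD1 x) xS.
have Sxy : #|S :\ x| = #|S :\ x :\ y|.+1 by rewrite (cardsD1 y) !inE eq_sym xy yS.
have deg : inner_deg E S x <= #|S :\ x :\ y|.
  apply/subset_leq_card/subsetP => z; rewrite !inE => /andP[zS xz].
  rewrite zS andbT; apply/andP; split; first by apply: contraNneq nxy => <-.
  by apply: contraTneq xz => ->; rewrite adj_irr.
have {}IH : #|inner E (S :\ x)| <= turan w #|S :\ x| by apply: IH; rewrite -ltnS -Sx.
have := inner_le_add S x.
have := turanK #|S| w0; have := turanK #|S :\ x| w0; rewrite Sx binS bin1.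
by rewrite Sx in Sw; lia.
Qed.

Lemma clique_path k (C : {set V}) : clique E C -> k <= #|C| -> has_path (adj E) k.
Proof.
move=> /cliqueP cl kC; apply/has_pathP; exists (enum C); rewrite enum_uniq -cardE; split => //.
have := enum_uniq C; have : {subset enum C <= C} by move=> x; rewrite mem_enum.
elim: (enum C) => //= x [|y s] IH //= sC /andP[xs us].
rewrite -[path _ _ _]/(sorted (adj E) (y :: s)) IH ?andbT //;
  last by move=> z zs; apply: sC; rewrite inE zs orbT.
apply: cl; rewrite ?sC ?mem_head // ?inE ?eqxx ?orbT //.
by apply: contraNneq xs => ->; rewrite mem_head.
Qed.

Lemma clique_deg (C : {set V}) x : clique E C -> x \in C -> inner_deg E C x = #|C|.-1.
Proof.
move=> /cliqueP cl xC; rewrite (cardsD1 x) xC /=; apply: eq_card => y.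
rewrite !inE; have [->|yx] := eqVneq y x; first by rewrite adj_irr // andbF.
by have [yC|//] := boolP (y \in C); rewrite cl // eq_sym.
Qed.

End Peeling.

(** * The upper bound *)

Lemma sub_adj (V : finType) (E E' : {set {set V}}) : E \subset E' -> subrel (adj E) (adj E').
Proof. by move=> EE' x y; apply: (subsetP EE'). Qed.

(** Kopylov's dichotomy between an empty and a non-empty core of a saturated
    supergraph [F].  The graph [F] may contain large cliques; the bound on cliques is
    used only for the edges of [E] inside the core. *)
Lemma connected_bound (V : finType) (E : {set {set V}}) (S : {set V}) k w :
    {in E, forall e : {set V}, #|e| = 2} ->
    (forall C : {set V}, clique E C -> #|C| <= w) -> ~~ has_path (adj E) k ->
    k./2 <= w -> 1 < k -> k <= #|S| ->
    {in S &, forall x y, connect (adj (inner E S)) x y} ->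
  #|inner E S| <= turan_blocks k.-1 w #|S| \/
  #|inner E S| + 'C(k./2, 2) <= k./2.-1 * #|S|.
Proof.
move=> E2 cl noP hw k1 kS con; have w0 : 0 < w by lia.
pose pairs := [set e : {set V} | e \subset S & #|e| == 2].
pose P (F : {set {set V}}) := [&& inner E S \subset F, F \subset pairs & ~~ has_path (adj F) k].
have P0 : P (inner E S).
  rewrite /P subxx /=; apply/andP; split.
    by apply/subsetP => e; rewrite !inE => /andP[/E2-> ->].
  apply: contra noP => /has_pathP[s [us es ks]]; apply/has_pathP; exists s; split => //.
  by apply: sub_sorted es; apply: sub_adj; apply/subsetP => e; rewrite inE => /andP[].
case: (arg_maxnP (fun F : {set {set V}} => #|F|) P0) => F /and3P[EF Fpairs noPF] maxF.
have F2 : {in F, forall e : {set V}, #|e| = 2}.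
  by move=> e /(subsetP Fpairs); rewrite inE => /andP[_ /eqP].
have FS : inner F S = F.
  apply/setP => e; rewrite inE; have [/(subsetP Fpairs)|//] := boolP (e \in F).
  by rewrite inE => /andP[].
have conF : {in S &, forall x y, connect (adj F) x y}.
  move=> x y xS yS; apply: connect_sub (con x y xS yS) => u v uv.
  exact/connect1/(sub_adj EF).
have sat : {in S &, forall x y, x != y -> ~~ adj F x y -> has_path (adj ([set x; y] |: F)) k}.
  move=> x y xS yS xy nxy; apply: contraT => noP'.
  have /maxF : P ([set x; y] |: F).
    rewrite /P noP' (subset_trans EF (subsetUr _ _)) subUset Fpairs !andbT /=.
    by rewrite sub1set inE cards2 xy eqxx andbT subUset !sub1set xS.
  by rewrite cardsU1 [_ \notin _]nxy add1n /= ltnn.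
have joined (X Y : {set V}) a b : X \subset S -> Y \subset S ->
    {in X, forall x, a <= inner_deg F X x} -> {in Y, forall y, b <= inner_deg F Y y} ->
    0 < a -> 0 < b -> k <= (a + b).+1 ->
    {in X & Y, forall x y, x != y -> adj F x y}.
  move=> /subsetP XS /subsetP YS aX bY a0 b0 kab.
  apply: (dense_sets_joined F2 _ _ aX bY a0 b0 kab noPF).
    by move=> x y /XS xS /YS yS; apply: conF.
  by move=> x y /XS xS /YS yS; apply: sat.
have h0 : 0 < k./2 by rewrite half_gt0.
have hE : k./2.-1.+1 = k./2 by rewrite prednK.
(* The threshold [k./2] makes two core degrees add up to at least [k - 1]. *)
have [C [CS dC _ maxC]] := peeling F2 k./2.-1 S.
have {}dC : {in C, forall x, k./2 <= inner_deg F C x}.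
  by move=> x xC; move/forall_inP: dC => /(_ x xC); rewrite hE.
have [C0|[x0 x0C]] := set_0Vmem C.
  right; have hS : k./2.-1 <= #|S| by lia.
  have := @degenerate_bound _ _ F2 k./2.-1 S _ hS; rewrite hE FS.
  have noD : forall X : {set V}, X \subset S -> dense F k./2.-1 X -> X = set0.
    by move=> X XS /(maxC X XS); rewrite C0 subset0 => /eqP.
  move=> /(_ noD); apply: leq_trans; rewrite leq_add2r.
  exact: subset_leq_card.
left; have clC : clique F C.
  by apply/cliqueP; apply: (joined C C k./2 k./2) => //; lia.
have hC : k./2 < #|C|.
  by have := dC x0 x0C; rewrite (clique_deg F2 clC x0C); lia.
have Ck : #|C| < k by rewrite ltnNge; apply: contra noPF; apply: clique_path.
(* The threshold of the second peeling is the largest one for which a surviving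
vertex is forced to be adjacent to the whole core. *)
have [j jE] : exists j, #|C| + j = k.-1 by exists (k.-1 - #|C|); lia.
have [jC kCj jk] : [/\ j < #|C|.-1, k <= (#|C|.-1 + j.+1).+1 & j.+1.*2 <= k.-1].
  by move: jE hC Ck; clear; move: #|C| => s; split; lia.
have [tw tS] : k.-1 <= w.*2 /\ k.-1 <= #|S|.
  by move: hw kS; clear; move: #|S| => s; lia.
have C0 : 0 < #|C|.-1 by apply: leq_ltn_trans jC.
have [C2 [C2S dC2 peel2 maxC2]] := peeling F2 j S.
have CC2 : C \subset C2.
  apply: maxC2 => //; apply/forall_inP => x xC; by rewrite (clique_deg F2 clC xC).
have C2C : C2 \subset C.
  apply/subsetP => y yC2; apply: contraT => yC.
  have joined2 : {in C & C2, forall x y, x != y -> adj F x y}.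
    apply: (joined C C2 #|C|.-1 j.+1) => //.
    - by move=> x xC; rewrite (clique_deg F2 clC xC).
    - by move=> x xC2; move/forall_inP: dC2 => /(_ x xC2).
  (* A vertex joined to all of [C] could be added to the first core. *)
  have yCS : y |: C \subset S by rewrite subUset sub1set (subsetP C2S).
  have /(maxC _ yCS) : dense F k./2.-1 (y |: C).
    apply/forall_inP => x; rewrite hE => /setU1P[->|xC]; last first.
      by apply: leq_trans (dC x xC) (inner_deg_mono _ _ (subsetUr _ _)).
    apply: leq_trans (ltnW hC) _; apply/subset_leq_card/subsetP => z zC.
    rewrite !inE zC orbT /= adj_sym joined2 //.
    by apply: contraNneq yC => <-.
  by rewrite subUset sub1set (negPf yC).
have {C2C CC2}C2E : C2 = C by apply/eqP; rewrite eqEsubset C2C.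
rewrite C2E FS in peel2.
apply: leq_trans (_ : turan w #|C| + j * (#|S| - #|C|) <= _); last first.
  exact: turan_core_bound.
rewrite -(cardsID (inner E C) (inner E S)) leq_add //.
  by apply: leq_trans (subset_leq_card (subsetIr _ _)) (clique_free_bound E2 C w0 cl).
apply: leq_trans peel2; apply/subset_leq_card/subsetP => e /setDP[eS eC].
rewrite inE (subsetP EF e eS) andbT; apply: contra eC; rewrite !inE => /andP[_ ->].
by move: eS; rewrite inE andbT => /andP[].
Qed.

(** One side is the component of [x]. *)
Lemma inner_split (V : finType) (E : {set {set V}}) (S : {set V}) x y :
    {in E, forall e : {set V}, #|e| = 2} ->
    x \in S -> y \in S -> ~~ connect (adj (inner E S)) x y ->
  exists A B : {set V}, [/\ #|S| = #|A| + #|B|, #|A| < #|S|, #|B| < #|S| &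
    #|inner E S| <= #|inner E A| + #|inner E B|].
Proof.
move=> E2 xS yS nxy; pose A := [set z in S | connect (adj (inner E S)) x z].
exists A, (S :\: A).
have AS : A \subset S by apply/subsetP => z; rewrite inE => /andP[].
have xA : x \in A by rewrite inE xS connect0.
have SAB : #|S| = #|A| + #|S :\: A| by rewrite -(cardsID A S) (setIidPr AS).
split => //.
- apply: proper_card; rewrite properE AS; apply/subsetPn; exists y => //.
  by rewrite inE yS.
- by rewrite SAB -[X in X < _]add0n ltn_add2r (cardD1 x) xA.
apply: leq_trans (leq_card_setU _ _).1; apply/subset_leq_card/subsetP => e eES.
have := eES; rewrite !inE => /andP[eE eS]; rewrite eE /=.
have /cards2P[u [v [uv eE']]] : #|e| == 2 by rewrite (E2 e eE).
subst e; move: eS; rewrite !subUset !sub1set => /andP[uS vS].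
have uvA : (u \in A) = (v \in A).
  rewrite !inE uS vS /=; apply/idP/idP => c; apply: connect_trans c (connect1 _) => //.
  by rewrite adj_sym.
by rewrite !(inE, uS, vS) -/A in uvA *; case: (connect _ x u) uvA => /= <-.
Qed.

(** The hub alternative is kept for even [k] only: for odd [k] the tangent line
    with [j = k./2 - 1] puts it below the block value, and this is needed since
    there the blocks may be steeper than the hub graph. *)
Lemma edge_bound (V : finType) (E : {set {set V}}) k w (S : {set V}) :
    {in E, forall e : {set V}, #|e| = 2} ->
    (forall C : {set V}, clique E C -> #|C| <= w) -> ~~ has_path (adj E) k ->
    k./2 <= w -> 2 < k ->
  #|inner E S| <= turan_blocks k.-1 w #|S| \/
  ~~ odd k /\ #|inner E S| + 'C(k./2, 2) <= k./2.-1 * #|S|.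
Proof.
move=> E2 cl noP hw k2; have w0 : 0 < w by lia. have t0 : 0 < k.-1 by lia.
have [n] := ubnP #|S|; elim: n S => // n IH S; rewrite ltnS => Sn.
have [con|] := boolP [forall x in S, forall y in S, connect (adj (inner E S)) x y]; last first.
  case/forall_inPn => x xS /forall_inPn[y yS nxy].
  have [A [B [SAB AS BS le]]] := inner_split E2 xS yS nxy.
  have IHA := IH A (leq_trans AS Sn); have IHB := IH B (leq_trans BS Sn).
  rewrite SAB.
  have [ok|ok] := boolP (odd k).
    left; apply: leq_trans le _.
    apply: leq_trans (turan_blocks_superadd #|A| #|B| w0 t0); apply: leq_add.
      by case: IHA => // -[]; rewrite ok.
    by case: IHB => // -[]; rewrite ok.
  have tE : k.-1 = k./2.-1.*2.+1 by lia.
  have lin m := turan_blocks_le_linear w m t0 tE.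
  have linA := lin #|A|; have linB := lin #|B|.
  rewrite mulnDr; case: IHA => [IHA|[_ IHA]]; case: IHB => [IHB|[_ IHB]].
  - left; apply: leq_trans le _.
    exact: leq_trans (leq_add IHA IHB) (turan_blocks_superadd #|A| #|B| w0 t0).
  - by right; split => //; lia.
  - by right; split => //; lia.
  - by right; split => //; lia.
have {}con : {in S &, forall x y, connect (adj (inner E S)) x y}.
  by move=> x y xS yS; move/forall_inP: con => /(_ x xS)/forall_inP/(_ y yS).
have [kS|Sk] := leqP k #|S|; last first.
  left; rewrite turan_blocks_small //; last by rewrite -ltnS prednK // (ltn_trans _ k2).
  exact: clique_free_bound.
have [|le] := connected_bound E2 cl noP hw (ltnW k2) kS con; first by left.
have [ok|ok] := boolP (odd k); [left|by right].
have tE : k.-1 = k./2.*2 by lia.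
have := @turan_blocks_tangent k.-1 w k./2.-1 #|S|.
rewrite tE leq_double prednK; last by lia.
move=> /(_ hw); rewrite leq_double leqnn => /(_ isT).
by move: le; rewrite -tE; lia.
Qed.

(** * The two extremal constructions *)

Lemma sgraph_card2 (V : finType) (G : sgraph V) : {in edges G, forall e : {set V}, #|e| = 2}.
Proof. by move=> e eG; apply/eqP; apply: (forall_inP (edges_card2 G)). Qed.

Lemma inner_setT (V : finType) (E : {set {set V}}) : inner E setT = E.
Proof. by apply/setP => e; rewrite inE subsetT andbT. Qed.

Lemma clique_has_complete (V : finType) (G : sgraph V) (C : {set V}) r :
  clique (edges G) C -> r <= #|C| -> has_subgraph (complete r) G.
Proof.
move=> /cliqueP cl rC; apply/existsP.
pose f (i : 'I_r) := enum_val (widen_ord rC i).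
have f_inj : injective f by move=> i j /enum_val_inj/(congr1 val) /= /val_inj.
exists (finfun f); apply/andP; split.
  by apply/injectiveP => i j; rewrite !ffunE => /f_inj.
apply/forall_inP => e; rewrite inE => /cards2P[i [j [ij ->]]].
rewrite imsetU !imset_set1 !ffunE.
by apply: cl; rewrite ?enum_valP // (inj_eq f_inj).
Qed.

Lemma has_path_has_path_graph (V : finType) (G : sgraph V) k :
  has_path (adj (edges G)) k -> has_subgraph (path_graph k) G.
Proof.
case/existsP => s /andP[us es]; apply/existsP; exists (finfun (tnth s)).
apply/andP; split.
  by apply/injectiveP => i j; rewrite !ffunE; move/tuple_uniqP: us; apply.
apply/forall_inP => e /imsetP[[i j]]; rewrite inE /= => /eqP ij ->.
rewrite imsetU !imset_set1 !ffunE -/(adj _ _ _).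
have x0 := tnth s i; rewrite !(tnth_nth x0) ij.
by apply: (sortedP _ es); rewrite size_tuple -ij.
Qed.

Section BackDegree.
Variables (n : nat) (a : rel nat).

(** Both constructions are given by a relation between numbers that is read
    only from the smaller to the larger one, so that edges can be counted at their
    larger end. *)
Definition nat_edges : {set {set 'I_n}} :=
  [set [set u.1; u.2] | u : 'I_n * 'I_n & (u.1 < u.2) && a u.1 u.2].

Lemma nat_edges_card2 : [forall e in nat_edges, #|e| == 2].
Proof.
apply/forall_inP => e /imsetP[[x y]]; rewrite inE /= => /andP[xy _] ->.
by rewrite cards2 -val_eqE neq_ltn xy.
Qed.

Definition nat_graph : sgraph 'I_n := SGraph nat_edges_card2.

Lemma nat_edges_inv (x y : 'I_n) : x != y -> [set x; y] \in nat_edges ->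
  (x < y /\ a x y) \/ (y < x /\ a y x).
Proof.
move=> xy /imsetP[[u v]]; rewrite inE /= => /andP[uv auv] E.
by have [[-> ->]|[-> ->]] := set2_inj E xy; [left|right].
Qed.

Lemma has_subgraph_adj (U : finType) (H : sgraph U) : has_subgraph H nat_graph ->
  exists2 f : U -> 'I_n, injective f & forall x y, [set x; y] \in edges H ->
    (f x < f y /\ a (f x) (f y)) \/ (f y < f x /\ a (f y) (f x)).
Proof.
case/existsP => f /andP[/injectiveP f_inj /forall_inP fE]; exists f => // x y xyH.
apply: nat_edges_inv.
  rewrite (inj_eq f_inj); apply/negP => /eqP xy.
  by have := sgraph_card2 xyH; rewrite xy setUid cards1.
by have := fE _ xyH; rewrite imsetU !imset_set1.
Qed.

Lemma card_nat_edges : #|nat_edges| = \sum_(0 <= v < n) count (a^~ v) (iota 0 v).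
Proof.
rewrite card_in_imset; last first.
  move=> [x y] [u v]; rewrite !inE /= => /andP[xy _] /andP[uv _] E.
  have [|[-> ->]//|[uE vE]] := set2_inj E; first by rewrite -val_eqE neq_ltn xy.
  by move: xy uv; rewrite uE vE => xy /(ltn_trans xy); rewrite ltnn.
rewrite -sum1_card (eq_bigl (fun u : 'I_n * 'I_n => (u.1 < u.2) && a u.1 u.2)); last first.
  by move=> u; rewrite inE.
rewrite big_mkcond -(pair_bigA _ (fun x y : 'I_n => if (x < y) && a x y then 1 else 0)) /=.
rewrite exchange_big big_mkord /=; apply: eq_bigr => v _.
have -> : iota 0 v = index_iota 0 v by rewrite /index_iota subn0.
rewrite -sum1_count [RHS]big_mkcond /=.
rewrite -(big_mkord xpredT (fun x => if (x < v) && a x v then 1 else 0)).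
rewrite (big_cat_nat (n := v)) //=; last exact: ltnW.
rewrite [X in _ + X]big_nat [X in _ + X]big1 ?addn0; last first.
  by move=> i /andP[vi _]; rewrite ltnNge vi.
by apply: eq_big_nat => i /andP[_ ->].
Qed.

End BackDegree.

(** Within a block of at most [2 w] numbers, a number misses exactly the one at
    distance [w]: the parts of the Turan graph are the residue classes modulo [w]. *)
Definition block_rel t w : rel nat := fun u v => (u %/ t == v %/ t) && (v - u != w).

Lemma turanS w q : 0 < w -> turan w q.+1 = turan w q + (q - (w <= q)).
Proof.
move=> w0; have := turanK q w0; have := turanK q.+1 w0; rewrite binS bin1; lia.
Qed.

(** The new vertex is joined to the [n %% t] earlier ones of its block, except
    for the one that shares its part. *)
Lemma turan_blocksS t w n : 0 < t -> 0 < w ->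
  turan_blocks t w n.+1 = turan_blocks t w n + (n %% t - (w <= n %% t)).
Proof.
move=> t0 w0; rewrite /turan_blocks -addnA -turanS //.
have nt := ltn_pmod n t0.
have -> : n.+1 = n %/ t * t + (n %% t).+1 by rewrite addnS -divn_eq.
rewrite divnMDl // modnMDl.
have [lt|] := ltnP (n %% t).+1 t; first by rewrite (divn_small lt) (modn_small lt) addn0.
move=> le; have -> : (n %% t).+1 = t by apply/eqP; rewrite eqn_leq nt le.
by rewrite divnn t0 modnn turan0 addn0 mulnDl mul1n.
Qed.

Lemma count_block_rel t w v : 0 < t ->
  v %% t - (w <= v %% t) <= count (block_rel t w ^~ v) (iota 0 v).
Proof.
move=> t0; set q := v %% t; have qv : q <= v := leq_mod v t.
have -> : iota 0 v = iota 0 (v - q) ++ iota (v - q) q.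
  by rewrite -{2}[v - q]add0n -iotaD subnK.
rewrite count_cat; apply: leq_trans (leq_addl _ _).
rewrite (@eq_in_count _ _ (predC (fun u => v - u == w))); last first.
  move=> u; rewrite mem_iota subnK // /block_rel => /andP[qu uv] /=.
  suff -> : u %/ t = v %/ t by rewrite eqxx.
  have vq : v - q = v %/ t * t by rewrite {1}(divn_eq v t) addnK.
  have -> : u = v %/ t * t + (u - (v - q)) by rewrite -vq subnKC.
  have lt : u - (v - q) < t by apply: leq_ltn_trans (ltn_pmod v t0); lia.
  by rewrite divnMDl // (divn_small lt) addn0.
rewrite -[X in X - _](size_iota (v - q) q) -(count_predC (fun u => v - u == w)).
rewrite leq_subLR leq_add2r.
have [wq|wq] := leqP w q.
  rewrite (@eq_in_count _ _ (pred1 (v - w))) ?count_uniq_mem ?iota_uniq ?leq_b1 //.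
  by move=> u; rewrite mem_iota subnK //= => /andP[? ?]; apply/eqP/eqP; lia.
rewrite leqn0 -(count_pred0 (iota (v - q) q)); apply/eqP/eq_in_count => u.
by rewrite mem_iota subnK // => /andP[? ?]; apply/negbTE/eqP; lia.
Qed.

Lemma block_graph_edges t w n : 0 < t -> 0 < w ->
  turan_blocks t w n <= #|edges (nat_graph n (block_rel t w))|.
Proof.
move=> t0 w0; rewrite card_nat_edges.
elim: n => [|n IH]; first by rewrite /turan_blocks div0n mod0n.
by rewrite big_nat_recr //= turan_blocksS // leq_add ?count_block_rel.
Qed.

(** Adjacent vertices differ modulo [w], since a difference smaller than [2 w]
    that is a multiple of [w] can only be [w]. *)
Lemma block_graph_no_complete t w n r : 0 < t <= w.*2 -> 0 < w -> w < r ->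
  ~~ has_subgraph (complete r) (nat_graph n (block_rel t w)).
Proof.
move=> /andP[t0 tw] w0 wr; apply/negP => /has_subgraph_adj[f f_inj fE].
suff res_inj : injective (fun i => Ordinal (ltn_pmod (f i) w0)).
  by have := leq_card _ res_inj; rewrite !card_ord leqNgt wr.
have resP (u v : nat) : u < v -> block_rel t w u v -> u %% w = v %% w -> False.
  move=> uv /andP[/eqP uvt /eqP uvw] uvr.
  have : w %| v - u by rewrite -eqn_mod_dvd ?uvr // ltnW.
  have vut : v - u < t.
    by rewrite (divn_eq u t) (divn_eq v t) uvt subnDl (leq_ltn_trans (leq_subr _ _)) ?ltn_pmod.
  by case/dvdnP => -[|[|m]] vuE; move: uv vut uvw; nia.
move=> i j /(congr1 val) /= ij; apply/eqP; apply: contraT => nij.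
have [|[lt ft]|[lt ft]] := fE i j; first by rewrite inE cards2 nij.
  by case: (resP _ _ lt ft).
by case: (resP _ _ lt ft).
Qed.

(** A path stays within one block, and a block has only [t] vertices. *)
Lemma block_graph_no_path t w n k : 0 < t -> t < k ->
  ~~ has_subgraph (path_graph k) (nat_graph n (block_rel t w)).
Proof.
case: k => // k t0 tk; apply/negP => /has_subgraph_adj[f f_inj fE].
have same (i : 'I_k.+1) : f i %/ t = f ord0 %/ t.
  case: i; elim=> [|i IH] i_lt; first by congr (f _ %/ t); apply: val_inj.
  rewrite -(IH (ltnW i_lt)); set x := Ordinal (ltnW i_lt); set y := Ordinal i_lt.
  have [|[_ /andP[/eqP]]|[_ /andP[/eqP]]] // := fE x y.
  by apply/imsetP; exists (x, y); rewrite ?inE.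
suff res_inj : injective (fun i => Ordinal (ltn_pmod (f i) t0)).
  by have := leq_card _ res_inj; rewrite !card_ord leqNgt tk.
move=> i j /(congr1 val) /= ij; apply: f_inj; apply: val_inj.
by rewrite /= (divn_eq (f i) t) (divn_eq (f j) t) ij !same.
Qed.

Definition hub_rel d : rel nat := fun u _ => u < d.

Lemma hub_graph_edges d n : d <= n ->
  #|edges (nat_graph n (hub_rel d))| = 'C(d, 2) + d * (n - d).
Proof.
move=> dn; rewrite card_nat_edges -(subnKC dn) addKn.
have cnt v : count (hub_rel d ^~ v) (iota 0 v) = minn d v.
  have [dv|vd] := leqP d v.
    rewrite -(subnKC dv) iotaD count_cat.
    rewrite (@eq_in_count _ _ predT) ?count_predT ?size_iota; last first.
      by move=> u; rewrite mem_iota /hub_rel => /andP[_ ->].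
    rewrite (@eq_in_count _ _ pred0) ?count_pred0 ?addn0 //.
    by move=> u; rewrite mem_iota /hub_rel => /andP[du _]; apply/negbTE; rewrite -leqNgt.
  rewrite (@eq_in_count _ _ predT) ?count_predT ?size_iota //.
  by move=> u; rewrite mem_iota /hub_rel => /andP[_ /ltn_trans->].
rewrite (eq_bigr _ (fun v _ => cnt v)).
elim: (n - d) => [|m IH]; last first.
  by rewrite addnS big_nat_recr //= IH (minn_idPl (leq_addr _ _)) mulnS; lia.
rewrite addn0 muln0 addn0 -bin2_sum; apply: eq_big_nat => v /andP[_ vd].
by rewrite (minn_idPr (ltnW vd)).
Qed.

(** A clique contains at most one vertex that is not a hub. *)
Lemma hub_graph_no_complete d n r : d.+1 < r ->
  ~~ has_subgraph (complete r) (nat_graph n (hub_rel d)).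
Proof.
move=> dr; apply/negP => /has_subgraph_adj[f f_inj fE].
suff min_inj : injective (fun i => inord (minn (f i) d) : 'I_d.+1).
  by have := leq_card _ min_inj; rewrite !card_ord leqNgt dr.
move=> i j /(congr1 (@nat_of_ord _)); rewrite !inordK ?ltnS ?geq_minr // => ij.
apply/eqP; apply: contraT => nij; have : f i != f j by rewrite (inj_eq f_inj).
rewrite -val_eqE /= => /eqP.
have [|[lt ft]|[lt ft]] := fE i j; first by rewrite inE cards2 nij.
  by move: lt ft; rewrite /hub_rel; lia.
by move: lt ft; rewrite /hub_rel; lia.
Qed.

(** Each of the [d + 1] disjoint edges at positions [2 i] and [2 i + 1] of the
    path contains a hub. *)
Lemma hub_graph_no_path d n k : d.+1.*2 <= k ->
  ~~ has_subgraph (path_graph k) (nat_graph n (hub_rel d)).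
Proof.
move=> dk; apply/negP => /has_subgraph_adj[f f_inj fE].
have lt1 (i : 'I_d.+1) : i.*2 < k by have := ltn_ord i; lia.
have lt2 (i : 'I_d.+1) : i.*2.+1 < k by have := ltn_ord i; lia.
pose x i := f (Ordinal (lt1 i)); pose y i := f (Ordinal (lt2 i)).
have xyd i : minn (x i) (y i) < d.
  have [||] := fE (Ordinal (lt1 i)) (Ordinal (lt2 i)).
  - by apply/imsetP; exists (Ordinal (lt1 i), Ordinal (lt2 i)); rewrite ?inE /=.
  - by rewrite -/(x i) -/(y i) /hub_rel; lia.
  - by rewrite -/(x i) -/(y i) /hub_rel; lia.
suff min_inj : injective (fun i => Ordinal (xyd i)).
  by have := leq_card _ min_inj; rewrite !card_ord ltnn.
have eq_f i j : f i = f j :> nat -> i = j :> nat by move=> /val_inj/f_inj->.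
move=> i j /(congr1 val) /=; rewrite /x /y => ij; apply: val_inj => /=.
have [] : [\/ i.*2 = j.*2, i.*2 = j.*2.+1, i.*2.+1 = j.*2 | i.*2.+1 = j.*2.+1].
  move: ij; rewrite /minn; case: ltnP => _; case: ltnP => _ /eq_f /= E.
  - exact: Or41.
  - exact: Or42.
  - exact: Or43.
  - exact: Or44.
all: lia.
Qed.

(** * The extremal number *)

Lemma complete_free_clique (V : finType) (G : sgraph V) r : 0 < r ->
  ~~ has_subgraph (complete r) G -> forall C : {set V}, clique (edges G) C -> #|C| <= r.-1.
Proof.
move=> r0 noK C cl; rewrite -ltnS prednK // ltnNge.
by apply: contra noK; apply: clique_has_complete.
Qed.

Lemma ex_complete r s : 1 < r -> s <= r.-1.*2 -> ex_single s (complete r) = turan r.-1 s.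
Proof.
move=> r1 sr; have w0 : 0 < r.-1 by rewrite -ltnS prednK // ltnW.
apply/eqP; rewrite eqn_leq; apply/andP; split.
  apply/bigmax_leqP => G; rewrite /is_free /= orbF => noK.
  have := clique_free_bound (sgraph_card2 (G := G)) setT w0 (complete_free_clique (ltnW r1) noK).
  by rewrite inner_setT cardsT card_ord.
have [-> //|s0] := posnP s.
rewrite -(@turan_blocks_small s) //; apply: leq_trans (block_graph_edges s s0 w0) _.
apply: leq_bigmax_cond; rewrite /is_free /= orbF.
by apply: block_graph_no_complete; rewrite ?s0 // prednK // ltnW.
Qed.

Lemma free_edges_le n k r (G : sgraph 'I_n) : 2 < k -> 1 < r -> k./2 <= r.-1 ->
    is_free [:: FinGraph (complete r); FinGraph (path_graph k)] G ->
  #|edges G| <= turan_blocks k.-1 r.-1 n \/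
  ~~ odd k /\ #|edges G| + 'C(k./2, 2) <= k./2.-1 * n.
Proof.
move=> k2 r1 kr; rewrite /is_free /= orbF negb_or => /andP[noK noP].
have noP' : ~~ has_path (adj (edges G)) k.
  by apply: contra noP; apply: has_path_has_path_graph.
have := edge_bound setT (sgraph_card2 (G := G)) (complete_free_clique (ltnW r1) noK)
  noP' kr k2.
by rewrite inner_setT cardsT card_ord.
Qed.

Lemma ex_family_ge_blocks n k r : 2 < k -> 1 < r -> k./2 <= r.-1 ->
  turan_blocks k.-1 r.-1 n
    <= ex_family n [:: FinGraph (complete r); FinGraph (path_graph k)].
Proof.
move=> k2 r1 kr; have [w0 t0] : 0 < r.-1 /\ 0 < k.-1 by lia.
apply: leq_trans (block_graph_edges n t0 w0) _.
apply: leq_bigmax_cond; rewrite /is_free /= orbF negb_or; apply/andP; split.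
  by apply: block_graph_no_complete => //; lia.
by apply: block_graph_no_path => //; lia.
Qed.

Lemma ex_family_ge_hub n k r : 2 < k -> ~~ odd k -> k./2 < r -> k./2 <= n ->
  'C(k./2.-1, 2) + k./2.-1 * (n - k./2.-1)
    <= ex_family n [:: FinGraph (complete r); FinGraph (path_graph k)].
Proof.
move=> k2 k_even kr kn; rewrite -hub_graph_edges; last lia.
apply: leq_bigmax_cond; rewrite /is_free /= orbF negb_or; apply/andP; split.
  by apply: hub_graph_no_complete; lia.
by apply: hub_graph_no_path; lia.
Qed.

Theorem theorem6 (k r n p q : nat)
    (hr : k./2 + 1 <= r) (hrk : r < k) (hkn : k <= n)
    (hn : n = p * (k - 1) + q) (hq : q <= k - 2) :
  (3 <= k -> odd k ->
     ex_family n [:: FinGraph (complete r); FinGraph (path_graph k)]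
     = p * ex_single (k - 1) (complete r) + ex_single q (complete r))
  /\
  (4 <= k -> ~~ odd k ->
     ex_family n [:: FinGraph (complete r); FinGraph (path_graph k)]
     = maxn (p * ex_single (k - 1) (complete r) + ex_single q (complete r))
            ('C(k./2 - 1, 2) + (k./2 - 1) * (n - k./2 + 1))).
Proof.
have blocksE : 2 < k ->
    p * ex_single (k - 1) (complete r) + ex_single q (complete r)
    = turan_blocks k.-1 r.-1 n.
  move=> k2; have qk : q < k - 1 by lia.
  rewrite !ex_complete; try lia.
  have t0 : 0 < k - 1 by lia.
  by rewrite -(subn1 k) /turan_blocks hn divnMDl // modnMDl (divn_small qk) (modn_small qk) addn0.
have rk : k./2 <= r.-1 by lia.
split=> k3 k_parity.
  have r1 : 1 < r by lia.
  rewrite blocksE //; apply/eqP; rewrite eqn_leq ex_family_ge_blocks // andbT.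
  apply/bigmax_leqP => G /(free_edges_le k3 r1 rk)[//|[]].
  by rewrite k_parity.
have [k2 r1 hn'] : [/\ 2 < k, 1 < r & k./2 <= n] by split; lia.
have hubE : n - k./2 + 1 = n - k./2.-1 by lia.
rewrite blocksE // subn1 hubE; apply/eqP; rewrite eqn_leq geq_max.
rewrite ex_family_ge_blocks // ex_family_ge_hub //; last lia.
rewrite !andbT; apply/bigmax_leqP => G /(free_edges_le k2 r1 rk)[le|[_ le]].
  by rewrite leq_max le.
rewrite leq_max; apply/orP; right.
have := bin2_double k./2.-1; have hE : k./2 = k./2.-1.+1 by lia.
have [m nE] : exists m, n = k./2.-1 + m by exists (n - k./2.-1); lia.
have dnE : k./2.-1 * n = k./2.-1 * k./2.-1 + k./2.-1 * m by rewrite nE mulnDr.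
have -> : n - k./2.-1 = m by lia.
by move: le; rewrite {1}hE binS bin1 dnE; lia.
Qed.
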